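(* Let $n,d\ge 1$ be integers, let $f\in\mathcal{H}_{n,d}$ be a homogeneous polynomial with integer coefficients, with $\overline{f}>\underline{f}$, and assume that there exists a rational global minimizer of $f$ over $\Delta_n$, i.e. there is $x^*\in\Delta_n\cap\mathbb{Q}^n$ with $f(x^* )=\underline{f}$. Then $\rho_r(f)=O(1/r^2)$ as $r\to\infty$; that is, there is a constant $C$ (which may depend on $f$ but not on $r$) such that $\rho_r(f)\le C/r^2$ for all sufficiently large integers $r$.
   Context: $\mathcal{H}_{n,d}$ is the set of homogeneous polynomials of degree $d$ in $n$ variables with real coefficients. $\Delta_n=\{x\in\mathbb{R}^n: x_i\ge 0 \text{ for all } i,\ \sum_{i=1}^n x_i=1\}$ is the standard simplex. For an integer $r\ge1$, $\Delta(n,r)=\{x\in\Delta_n: rx\in\mathbb{N}^n\}$ (with $0\in\mathbb{N}$). Set $\underline{f}=\min_{x\in\Delta_n}f(x)$, $\overline{f}=\max_{x\in\Delta_n}f(x)$, $f_{\Delta(n,r)}=\min_{x\in\Delta(n,r)}f(x)$, and $$\rho_r(f)=\frac{f_{\Delta(n,r)}-\underline{f}}{\overline{f}-\underline{f}}.$$ *)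

(* Defs.v *)
From mathcomp Require Import all_boot all_order all_algebra.
From mathcomp Require Import boolp classical_sets reals filter.
From mathcomp Require Import mpoly.

Set Implicit Arguments.
Unset Strict Implicit.
Unset Printing Implicit Defensive.

Import Order.TTheory GRing.Theory Num.Theory.
Local Open Scope classical_set_scope.
Local Open Scope ring_scope.

(* A set without a least (resp. greatest) element gets the junk value 0. *)
Definition minimum (R : realType) (A : set R) : R := xget 0 (A `&` lbound A).

Definition maximum (R : realType) (A : set R) : R := xget 0 (A `&` ubound A).

Lemma minimumE (R : realType) (A : set R) (m : R) :
  A m -> lbound A m -> minimum A = m.
Proof.
move=> Am lm; apply: xget_unique => // y [Ay ly].
by apply/eqP; rewrite eq_le ly // lm.
Qed.

Lemma maximumE (R : realType) (A : set R) (m : R) :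
  A m -> ubound A m -> maximum A = m.
Proof.
move=> Am um; apply: xget_unique => // y [Ay uy].
by apply/eqP; rewrite eq_le uy // um.
Qed.

Definition simplex (R : realType) (n : nat) : set 'rV[R]_n :=
  [set x | (forall i, 0 <= x 0 i) /\ \sum_(i < n) x 0 i = 1].

Definition simplex_grid (R : realType) (n r : nat) : set 'rV[R]_n :=
  [set x | simplex x /\ forall i, r%:R * x 0 i \is a Num.nat].

Definition simplex_min (R : realType) (n : nat) (f : {mpoly R[n]}) : R :=
  minimum [set f.@[x 0] | x in @simplex R n].

Definition simplex_max (R : realType) (n : nat) (f : {mpoly R[n]}) : R :=
  maximum [set f.@[x 0] | x in @simplex R n].

Definition grid_min (R : realType) (n : nat) (f : {mpoly R[n]}) (r : nat) : R :=
  minimum [set f.@[x 0] | x in @simplex_grid R n r].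

Definition rho (R : realType) (n : nat) (f : {mpoly R[n]}) (r : nat) : R :=
  (grid_min f r - simplex_min f) / (simplex_max f - simplex_min f).

(* Main.v *)
Require Import Defs.
From mathcomp Require Import all_boot all_order all_algebra.
From mathcomp Require Import boolp classical_sets reals filter.
From mathcomp Require topology normedtype derive realfun.

Import Order.TTheory GRing.Theory Num.Theory.
Local Open Scope classical_set_scope.
Local Open Scope ring_scope.

(** Let [x] be a rational minimizer on the simplex, [m] a common denominator of
    its coordinates, and [j] an index with [x j > 0].  Dividing, [r = k m + s]
    with [s < m], and the point
        [y = (k (m x) + s e_j) / r = x + (s / r) (e_j - x)]
    lies in the grid of order [r] and within [O(1/r)] of [x].  Moreover [y] is
    on the line through [x] in the direction [v = e_j - x], and because
    [x j > 0] this line stays in the simplex for a while on the other side of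
    [x] too.  So [g t = f (x + t v)] is a univariate polynomial with an
    interior minimum at [0]: its linear term cannot contribute, hence
    [g t - g 0 <= C t ^ 2] on [0, 1] (lemma [quadratic_upper_bound]).  At
    [t = s / r <= m / r] this bounds the error of grid search by
    [C m ^ 2 / r ^ 2].

    This uses that [simplex_min f] and [grid_min f r] are lower bounds of the
    values of [f], that is, that both minima are attained: the former by
    compactness of the simplex, the latter because the grid is finite. *)

Module ExtremeValue.

Import topology normedtype derive realfun numFieldNormedType.Exports.

Lemma continuous_sum (R : realType) (T : topologicalType) (I : Type)
    (s : seq I) (F : I -> T -> R) : (forall i, continuous (F i)) ->
  continuous (fun x => \sum_(i <- s) F i x).
Proof.
by move=> cF; apply: continuous_big => //; exact: add_continuous.
Qed.

Lemma continuous_prod (R : realType) (T : topologicalType) (I : Type)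
    (s : seq I) (F : I -> T -> R) : (forall i, continuous (F i)) ->
  continuous (fun x => \prod_(i <- s) F i x).
Proof.
move=> cF; apply: continuous_big => // z.
by apply: cvgM; [exact: cvg_fst | exact: cvg_snd].
Qed.

(** The simplex is cut out of the cube [0, 1]^n by one closed condition. *)
Lemma compact_simplex (R : realType) (n : nat) : compact (@simplex R n).
Proof.
pose K := [set v : 'rV[R]_n | forall i, `[(0 : R), 1]%classic (v ord0 i)].
have -> : @simplex R n = K `&` [set v | \sum_(i < n) v 0 i = 1].
  apply/seteqP; split=> v /=.
    move=> [v0 v1]; split=> // i /=; rewrite in_itv /= v0 -v1.
    by rewrite (bigD1 i)//= lerDl sumr_ge0.
  move=> [Kv v1]; split=> // i.
  by have := Kv i; rewrite /= in_itv /= => /andP[].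
apply: compact_closedI.
  apply: (@rV_compact _ _ (fun=> `[(0 : R), 1]%classic)) => i.
  exact: segment_compact.
pose S (v : 'rV[R]_n) : R := \sum_(i < n) v 0 i.
apply: (@preimage_closed _ _ S [set x | x = 1]); last exact: closed_eq.
move=> v _; rewrite /S; move: v.
by apply: continuous_sum => i; exact: coord_continuous.
Qed.

(** The function [F] is [x |-> f.@[x 0]] for the polynomial with monomials [s],
    coefficients [c] and exponents [e], written out so that its continuity
    follows from that of sums, products and coordinates. *)
Lemma polynomial_argmin_simplex (R : realType) (n : nat) (I : Type) (s : seq I)
    (c : I -> R) (e : I -> 'I_n -> nat) (x0 : 'rV[R]_n) : simplex x0 ->
  let F (x : 'rV[R]_n) := \sum_(m <- s) c m * \prod_i x 0 i ^+ e m i in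
  exists2 x, simplex x & forall y, simplex y -> F x <= F y.
Proof.
move=> Sx0 F.
have cF : continuous F.
  apply: continuous_sum => m x.
  have cX i : continuous (fun x : 'rV[R]_n => x 0 i ^+ e m i).
    move=> y; apply: (@continuous_comp _ _ _ (fun x : 'rV[R]_n => x 0 i)
      (fun t : R => t ^+ e m i)); first exact: coord_continuous.
    exact: exprn_continuous.
  exact: (cvgMl_tmp (@continuous_prod R _ _ (index_enum 'I_n) _ cX x)).
have [||x] := @EVT_min_rV R n F (@simplex R n) _ (@compact_simplex R n).
- by exists x0.
- by apply: continuous_subspaceT.
by move=> /set_mem Sx Fx; exists x => // y Sy; apply: Fx; exact/mem_set.
Qed.

End ExtremeValue.

From mathcomp Require Import mpoly.
From mathcomp Require Import ring lra.


(** Taylor expansion at [0] to order two, by dividing out the root [0] twice. *)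
Lemma poly_expand2 (R : comNzRingType) (p : {poly R}) :
  exists b (s : {poly R}), forall t, p.[t] = p.[0] + b * t + s.[t] * t ^+ 2.
Proof.
have split0 (q : {poly R}) :
    exists q1 : {poly R}, forall t, q.[t] = q.[0] + q1.[t] * t.
  have /factor_theorem[q1 q1E] : root (q - q.[0]%:P) 0.
    by rewrite /root !hornerE subrr.
  exists q1 => t; have := congr1 (horner^~ t) q1E.
  by rewrite !hornerE subr0 => /eqP; rewrite subr_eq addrC => /eqP.
have [p1 p1E] := split0 p; have [s sE] := split0 p1.
exists p1.[0], s => t; rewrite p1E sE mulrDl addrA.
by rewrite expr2 mulrA.
Qed.

Lemma horner_bounded (R : numDomainType) (p : {poly R}) :
  exists2 M, 0 <= M & forall t, `|t| <= 1 -> `|p.[t]| <= M.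
Proof.
exists (\sum_(i < size p) `|p`_i|) => [|t t1]; first exact: sumr_ge0.
rewrite horner_coef; apply: le_trans (ler_norm_sum _ _ _) _.
apply: ler_sum => i _; rewrite normrM ler_piMr// normrX.
by rewrite exprn_ile1.
Qed.

(** Only minimality on the left of [0] is assumed: it forces the derivative at
    [0] to be nonpositive, so on the right the polynomial rises at most
    quadratically. *)
Lemma quadratic_upper_bound (R : realFieldType) (p : {poly R}) (e : R) :
    0 < e -> (forall u, 0 <= u <= e -> p.[0] <= p.[- u]) ->
  exists2 C, 0 <= C & forall t, 0 <= t <= 1 -> p.[t] - p.[0] <= C * t ^+ 2.
Proof.
move=> e0 pmin; have [b [s sE]] := poly_expand2 _ p.
have [M M0 sM] := horner_bounded _ s.
exists M => // t /andP[t0 t1].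
have b0 : b <= 0.
  rewrite leNgt; apply/negP => b0.
  (* If the slope [b] were positive, then at [- u] the linear gain [b * u] would
     exceed the quadratic term, which is at most [M * u ^ 2] with
     [M * u < b]. *)
  pose u := Num.min (Num.min e 1) (b / (M + 1)).
  have u0 : 0 < u by rewrite !lt_min e0 ltr01 divr_gt0// ltr_wpDl.
  have ue : u <= e by rewrite /u !ge_min lexx.
  have u1 : u <= 1 by rewrite /u !ge_min lexx orbT.
  have ub : u * (M + 1) <= b.
    by rewrite -ler_pdivlMr ?ltr_wpDl// /u ge_min lexx orbT.
  have := pmin u; rewrite ltW//= ue => /(_ isT).
  rewrite (sE (- u)) sqrrN => h.
  have : s.[- u] <= M.
    by apply: le_trans (ler_norm _) (sM _ _); rewrite normrN gtr0_norm.
  nra.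
have st : s.[t] <= M by apply: le_trans (ler_norm _) (sM _ _); rewrite ger0_norm.
have t2 : 0 <= t ^+ 2 by exact: sqr_ge0.
rewrite (sE t); nra.
Qed.

Lemma meval_line (R : comNzRingType) (n : nat) (f : {mpoly R[n]})
    (x v : 'I_n -> R) :
  exists p : {poly R}, forall t, p.[t] = f.@[fun i => x i + t * v i].
Proof.
exists (\sum_(m <- msupp f) f@_m *: \prod_i ((x i)%:P + v i *: 'X) ^+ m i) => t.
rewrite mevalE horner_sum; apply: eq_bigr => m _.
rewrite hornerZ horner_prod; congr (_ * _); apply: eq_bigr => i _.
by rewrite horner_exp !hornerE mulrC.
Qed.

(** By compactness some simplex point attains the least value, so
    [simplex_min f] is that value. *)
Lemma simplex_min_le (R : realType) (n : nat) (f : {mpoly R[n]})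
    (x : 'rV[R]_n) : simplex x -> simplex_min f <= f.@[x 0].
Proof.
move=> Sx; have [y Sy ymin] := ExtremeValue.polynomial_argmin_simplex _ _ _ (msupp f)
  (fun m => f@_m) (fun m i => m i) _ Sx.
have fmin z : simplex z -> f.@[y 0] <= f.@[z 0].
  by move=> Sz; rewrite !mevalE; exact: ymin.
rewrite (_ : simplex_min f = f.@[y 0]); first exact: fmin.
by apply: minimumE => [|_ [z Sz <-]]; [exists y | exact: fmin].
Qed.

(** Grid points are the vectors [h / r] with [h] integer and [0 <= h i <= r];
    there are finitely many such [h], so one of them minimizes [f]. *)
Lemma grid_min_le (R : realType) (n r : nat) (f : {mpoly R[n]})
    (x : 'rV[R]_n) : (0 < r)%N -> simplex_grid r x -> grid_min f r <= f.@[x 0].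
Proof.
move=> r0 Gx; have rR : r%:R != 0 :> R by rewrite pnatr_eq0 -lt0n.
pose pt (h : {ffun 'I_n -> 'I_r.+1}) : 'rV[R]_n := \row_i ((h i)%:R / r%:R).
have grid_pt z : simplex_grid r z -> exists h, z = pt h.
  move=> [[z0 z1] zr].
  have zi (i : 'I_n) : (Num.truncn (r%:R * z 0 i)%R < r.+1)%N.
    rewrite ltnS -(ler_nat R) truncnK//.
    by rewrite ler_piMr// -z1 (bigD1 i)//= lerDl sumr_ge0.
  exists [ffun i => Ordinal (zi i)]; apply/rowP => i; rewrite !mxE ffunE /=.
  by rewrite truncnK// mulrAC divff// mul1r.
have [h0 xE] := grid_pt _ Gx.
pose P h := `[< simplex_grid r (pt h) >].
have P0 : P h0 by apply/asboolP; rewrite -xE.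
case: (arg_minP (fun h => f.@[(pt h) 0]) P0) => h /asboolP Ph hmin.
have fmin z : simplex_grid r z -> f.@[(pt h) 0] <= f.@[z 0].
  by move=> Gz; have [k zE] := grid_pt _ Gz; rewrite zE hmin// /P -zE; apply/asboolP.
rewrite (_ : grid_min f r = f.@[(pt h) 0]); first exact: fmin.
by apply: minimumE => [|_ [z Gz <-]]; [exists (pt h) | exact: fmin].
Qed.

Lemma common_denominator (R : realType) (n : nat) (x : 'I_n -> R) :
    (forall i, rational (x i)) ->
  exists2 m, (0 < m)%N & forall i, m%:R * x i \is a Num.int.
Proof.
move=> xQ; have /choice[q qE] : forall i, exists q : rat, x i = ratr q.
  by move=> i; have [q _ <-] := xQ i; exists q.
exists (\prod_i `|denq (q i)|)%N.
  by rewrite prodn_gt0// => i; rewrite absz_gt0 denq_neq0.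
move=> i; rewrite qE (bigD1 i)//= natrM mulrAC rpredM ?natr_int//.
rewrite natr_absz normr_denq.
by rewrite /ratr mulrC divfK ?intr_eq0 ?denq_neq0 ?intr_int.
Qed.

Theorem corollary4p1 (R : realType) (n d : nat) (f : {mpoly R[n]})
    (n_ge1 : (1 <= n)%N) (d_ge1 : (1 <= d)%N)
    (f_homog : f \is d.-homog)
    (f_int : f \is a mpolyOver n Num.int)
    (f_nonconst : simplex_min f < simplex_max f)
    (f_ratmin : exists x : 'rV[R]_n,
        [/\ simplex x, forall i, rational (x 0 i) & f.@[x 0] = simplex_min f]) :
  exists C : R, \forall r \near \oo, rho f r <= C / r%:R ^+ 2.
Proof.
have [x [[x0 x1] xQ xmin]] := f_ratmin.
have [m m0 xm] := common_denominator _ _ _ xQ.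
have xN i : m%:R * x 0 i \is a Num.nat.
  by rewrite natrEint xm mulr_ge0.
have [j xj] : exists j, 0 < x 0 j.
  apply/not_existsP => xj; move: x1; rewrite big1 => [|i _].
    by move/eqP; rewrite eq_sym oner_eq0.
  by apply/eqP; rewrite eq_le x0 leNgt andbT; apply/negP/xj.
have xj1 : x 0 j <= 1 by rewrite -x1 (bigD1 j)//= lerDl sumr_ge0.
pose v i := (i == j)%:R - x 0 i.
have sumv : \sum_i v i = 0.
  by rewrite sumrB x1 (bigD1 j)//= eqxx big1 ?addr0 ?subrr// => i /negPf ->.
pose y t : 'rV[R]_n := \row_i (x 0 i + t * v i).
(* The lower limit is one for which coordinate [j], equal to
   [x j + t (1 - x j)], is still nonnegative; the others are [(1 - t) x i]. *)
have yS t : - x 0 j <= t <= 1 -> simplex (y t).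
  move=> /andP[tj t1]; split=> [i|].
    rewrite mxE /v; case: eqP => [->|_].
      have : 0 <= (t + x 0 j) * (1 - x 0 j) by rewrite mulr_ge0; lra.
      rewrite mulr1n; nra.
    have : 0 <= x 0 i * (1 - t) by rewrite mulr_ge0// subr_ge0.
    rewrite mulr0n; lra.
  under eq_bigr do rewrite mxE.
  by rewrite big_split /= -mulr_sumr sumv mulr0 addr0.
have [p pE] := meval_line _ _ f (fun i => x 0 i) v.
have py t : p.[t] = f.@[(y t) 0].
  by rewrite pE; apply: meval_eq => i; rewrite mxE.
have p0 : p.[0] = simplex_min f.
  by rewrite pE -xmin; apply: meval_eq => i; rewrite mul0r addr0.
have [||C C0 pC] := quadratic_upper_bound _ p (x 0 j) => //.
  move=> u /andP[u0 uj]; rewrite p0 py; apply: simplex_min_le; apply: yS.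
  by rewrite lerN2 uj (le_trans _ ler01)// oppr_le0.
have D0 : 0 < simplex_max f - simplex_min f by rewrite subr_gt0.
exists (C * m%:R ^+ 2 / (simplex_max f - simplex_min f)).
exists 1%N => // r /= r0.
have rR : 0 < r%:R :> R by rewrite ltr0n.
have mR : 0 < m%:R :> R by rewrite ltr0n.
(* The step for which [r *: y t] is [(r %/ m) *: (m *: x)] plus [r %% m] copies
   of the [j]-th unit vector. *)
pose t : R := (r %% m)%:R / r%:R.
have t0 : 0 <= t by rewrite divr_ge0.
have t1 : t <= 1 by rewrite ler_pdivrMr// mul1r ler_nat leq_mod.
have Gy : simplex_grid r (y t).
  split; first by apply: yS; rewrite t1 (le_trans _ t0)// oppr_le0.
  move=> i; rewrite mxE.
  have -> : r%:R * (x 0 i + t * v i)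
      = (r %/ m)%:R * (m%:R * x 0 i) + (r %% m)%:R * (i == j)%:R.
    rewrite mulrDr /t mulrA (mulrC r%:R (_ / _)) divfK ?(gt_eqF rR)// /v.
    have -> : r%:R = (r %/ m)%:R * m%:R + (r %% m)%:R :> R.
      by rewrite -natrM -natrD -divn_eq.
    ring.
  apply: rpredD; apply: rpredM; first [exact: natr_nat | exact: xN].
have tm : t <= m%:R / r%:R by rewrite ler_pM2r ?invr_gt0// ler_nat ltnW// ltn_mod.
rewrite /rho [leRHS]mulrAC ler_pM2r ?invr_gt0//.
apply: (@le_trans _ _ (p.[t] - p.[0])).
  by rewrite py p0 lerB// grid_min_le.
apply: le_trans (pC t _) _; first by rewrite t0.
rewrite -mulrA ler_wpM2l// -expr_div_n.
by rewrite lerXn2r ?nnegrE// ?divr_ge0.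
Qed.
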